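(* Let $f_1,\dots,f_N:\mathbb{R}^n\to\mathbb{R}$ satisfy (H1) and (H2) stated in the context, and let $(x_k)$ be the sequence generated by Algorithm X described in the context. If $\bar x$ is an accumulation point of $(x_k)$, then $\bar x$ is a stationary point of $\Phi$, i.e. $\Phi'(\bar x;d)\ge0$ for all $d\in\mathbb{R}^n$.
   Context: (H1): there is $M\in\mathbb{R}$ with $f_j(x)\ge M$ for all $x\in\mathbb{R}^n$ and $1\le j\le N$. (H2): each $f_j\in C^1(\mathbb{R}^n)$ and there is a modulus of continuity $w$ (increasing $w:[0,\infty)\to[0,\infty)$, $w(0)=0$, continuous at $0$) with $\|\nabla f_j(x)-\nabla f_j(y)\|\le w(\|x-y\|)$ for all $x,y$ and $j$. Let $\Phi(x)=\max_{1\le j\le N}f_j(x)$, and $g'(x;d)=\lim_{t\to0^+}\frac{g(x+td)-g(x)}{t}$ denotes the directional derivative. Algorithm X: set $x_0=0$, $c=\sigma=\tfrac12$. At iteration $k=0,1,2,\dots$: let $G\in\mathbb{R}^{N\times n}$ have $j$-th row $\nabla f_j(x_k)^T$, $f=(f_1(x_k),\dots,f_N(x_k))^T$; let $\lambda$ be a solution of $\min_\lambda(\tfrac12\lambda^TGG^T\lambda-f^T\lambda)$ subject to $\sum_i\lambda_i=1$, $\lambda_i\ge0$; set $p_k=-G^T\lambda$, and $d_k=0$ if $p_k=0$, otherwise $d_k=p_k/\|p_k\|$. If $d_k=0$ set $\alpha_k=1$; otherwise $\alpha_k=\sigma^j$ with $j$ the smallest nonnegative integer such that $\Phi(x_k+\sigma^jd_k)<\Phi(x_k)+c\sigma^j\Phi'(x_k;d_k)$.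 Set $x_{k+1}=x_k+\alpha_kd_k$. *)

(* Defs.v *)
From HB Require Import structures.
From mathcomp Require Import all_boot all_order all_algebra.
From mathcomp Require Import all_classical all_reals all_analysis.
Set Implicit Arguments. Unset Strict Implicit. Unset Printing Implicit Defensive.
Import Order.TTheory GRing.Theory Num.Theory.
Import numFieldNormedType.Exports.
Local Open Scope classical_set_scope.
Local Open Scope ring_scope.

Section Defs.
Variable R : realType.

(* Euclidean norm on R^n (the library norm on 'rV is the max norm). *)
Definition enorm n (v : 'rV[R]_n) : R := Num.sqrt (\sum_(i < n) v 0 i ^+ 2).

Definition grad n (g : 'rV[R]_n -> R) (x : 'rV[R]_n) : 'rV[R]_n :=
  \row_(i < n) 'D_(delta_mx 0 i) g x.

Definition C1 n (g : 'rV[R]_n -> R) : Prop :=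
  (forall x, differentiable g x) /\ continuous (grad g).

Definition dirder n (g : 'rV[R]_n -> R) (x d : 'rV[R]_n) : R :=
  lim ((fun t : R => (g (x + t *: d) - g x) / t) @ 0^'+).

Definition Phi N n (f : 'I_N.+1 -> 'rV[R]_n -> R) (x : 'rV[R]_n) : R :=
  \big[Num.max/f ord0 x]_(j < N.+1) f j x.

Definition modulus (w : R -> R) : Prop :=
  {in `[0, +oo[ &, nondecreasing w} /\ w 0 = 0 /\ w x @[x --> 0^'+] --> 0.

Definition Gmat N n (f : 'I_N.+1 -> 'rV[R]_n -> R) (x : 'rV[R]_n)
  : 'M[R]_(N.+1, n) := \matrix_(j, i) grad (f j) x 0 i.
Definition fvec N n (f : 'I_N.+1 -> 'rV[R]_n -> R) (x : 'rV[R]_n)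
  : 'cV[R]_N.+1 := \col_j f j x.

Definition in_simplex N (l : 'cV[R]_N.+1) : Prop :=
  \sum_(i < N.+1) l i 0 = 1 /\ forall i, 0 <= l i 0.

Definition qp_obj N n (f : 'I_N.+1 -> 'rV[R]_n -> R) (x : 'rV[R]_n)
  (l : 'cV[R]_N.+1) : R :=
  2^-1 * (l^T *m Gmat f x *m (Gmat f x)^T *m l) 0 0 - ((fvec f x)^T *m l) 0 0.

Definition algorithmX N n (f : 'I_N.+1 -> 'rV[R]_n -> R)
  (x : nat -> 'rV[R]_n) : Prop :=
  let c : R := 2^-1 in let sigma : R := 2^-1 in
  x 0%N = 0 /\
  forall k : nat, exists lam : 'cV[R]_N.+1,
    in_simplex lam /\
    (forall mu, in_simplex mu -> qp_obj f (x k) lam <= qp_obj f (x k) mu) /\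
    let p : 'rV[R]_n := - ((Gmat f (x k))^T *m lam)^T in
    let d : 'rV[R]_n := if p == 0 then 0 else (enorm p)^-1 *: p in
    let armijo (j : nat) : Prop :=
      Phi f (x k + sigma ^+ j *: d) <
        Phi f (x k) + c * sigma ^+ j * dirder (Phi f) (x k) d in
    (d = 0 -> x k.+1 = x k + 1 *: d) /\
    (d <> 0 -> exists j : nat, armijo j /\ (forall i, (i < j)%N -> ~ armijo i)
                               /\ x k.+1 = x k + sigma ^+ j *: d).

End Defs.

(* Main.v *)
Require Import Defs.
From HB Require Import structures.
From mathcomp Require Import all_boot all_order all_algebra.
From mathcomp Require Import all_classical all_reals all_analysis.
From mathcomp Require Import ring lra.
Import Order.TTheory GRing.Theory Num.Theory.
Import numFieldNormedType.Exports.
Local Open Scope classical_set_scope.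
Local Open Scope ring_scope.

(* The search direction [p] at [x] solves the strongly convex dual problem
   min_p max_j (f_j(x) + <grad f_j(x), p>) + |p|^2 / 2, so it depends continuously
   on [x], and it vanishes only at stationary points.  If the accumulation point
   [xb] were not stationary, [p] would be bounded away from 0 near [xb]; the
   decrease of [Phi] then makes the path finite, so the whole sequence converges
   to [xb], and since the directions are nearly constant it does so along the
   ray [xb - r p], where [r] is the remaining path length.

   Along this ray [Phi] may be steeper before [xb] than after it, so the slope at
   the iterate does not control the Armijo test on its own.  But with slope [- a]
   before [xb] and at most [- b] after it, where [a >= b > 0], a step [t] between
   [r] and [2 r] changes [Phi] by at most [- a r - b (t - r)], up to a small
   multiple of [r], which is below [- a t / 2] by a fixed multiple of [r].  All such
   steps are accepted, so the chosen step exceeds the remaining length [r], which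
   is absurd. *)

(** * Euclidean inner product and its comparison with the max norm *)

Section DotProduct.
Context {R : realType} {n : nat}.
Implicit Types (u v w : 'rV[R]_n) (a : R).

Definition dot u v : R := \sum_i u 0 i * v 0 i.

Lemma dotC u v : dot u v = dot v u.
Proof. by apply: eq_bigr => i _; rewrite mulrC. Qed.

Lemma dotDr u v w : dot u (v + w) = dot u v + dot u w.
Proof. by rewrite -big_split; apply: eq_bigr => i _; rewrite mxE mulrDr. Qed.

Lemma dotZr u a v : dot u (a *: v) = a * dot u v.
Proof. by rewrite mulr_sumr; apply: eq_bigr => i _; rewrite mxE mulrCA. Qed.

Lemma dot0r u : dot u 0 = 0.
Proof. by rewrite -(scale0r (0 : 'rV[R]_n)) dotZr mul0r. Qed.

Lemma dotNr u v : dot u (- v) = - dot u v.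
Proof. by rewrite -scaleN1r dotZr mulN1r. Qed.

Lemma dotBr u v w : dot u (v - w) = dot u v - dot u w.
Proof. by rewrite dotDr dotNr. Qed.

Lemma dotDl u v w : dot (v + w) u = dot v u + dot w u.
Proof. by rewrite dotC dotDr !(dotC u). Qed.

Lemma dotZl u a v : dot (a *: v) u = a * dot v u.
Proof. by rewrite dotC dotZr dotC. Qed.

Lemma dotNl u v : dot (- v) u = - dot v u.
Proof. by rewrite dotC dotNr dotC. Qed.

Lemma dotBl u v w : dot (v - w) u = dot v u - dot w u.
Proof. by rewrite dotDl dotNl. Qed.

Lemma dot_suml (I : finType) (F : I -> 'rV[R]_n) v :
  dot (\sum_j F j) v = \sum_j dot (F j) v.
Proof.
rewrite exchange_big; apply: eq_bigr => i _.
by rewrite summxE mulr_suml.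
Qed.

Lemma normr_coord_le v i : `|v 0 i| <= `|v|.
Proof.
rewrite [leRHS]mx_normrE.
exact: (le_bigmax 0 (fun ij => `|v ij.1 ij.2|) (0, i)).
Qed.

Lemma dot_ge0 v : 0 <= dot v v.
Proof. by apply: sumr_ge0 => i _; rewrite -expr2 sqr_ge0. Qed.

(** [|v|] is the max norm, attained at some coordinate; its square is a single term of the sum of
    squares. *)
Lemma sqr_norm_le_dot v : `|v| ^+ 2 <= dot v v.
Proof.
have [->|v0] := eqVneq v 0; first by rewrite normr0 expr0n dot_ge0.
have [|[i j] vij] := @mx_norm_neq0 _ _ _ v.
  by apply: contra_neq v0 => /mx_norm_eq0.
rewrite [X in X ^+ 2]vij ord1 real_normK ?num_real //= /dot (bigD1 j) //= -expr2 lerDl.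
by apply: sumr_ge0 => k _; rewrite -expr2 sqr_ge0.
Qed.

(* [n.+1] instead of [n], so that the constant is at least 1 in dimension 0 too. *)
Lemma norm_dot_le u v : `|dot u v| <= n.+1%:R * `|u| * `|v|.
Proof.
apply: (@le_trans _ _ (n%:R * `|u| * `|v|)); last first.
  by rewrite -!mulrA ler_wpM2r ?mulr_ge0 // ler_nat.
apply: le_trans (ler_norm_sum _ _ _) _.
rewrite -mulrA mulr_natl -[X in _ *+ X]card_ord -sumr_const ler_sum // => i _.
by rewrite normrM ler_pM // normr_coord_le.
Qed.

Lemma enorm_sqr v : enorm v ^+ 2 = dot v v.
Proof.
by rewrite sqr_sqrtr ?sumr_ge0 // => i _; rewrite sqr_ge0.
Qed.

Lemma enorm_ge0 v : 0 <= enorm v.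
Proof. exact: sqrtr_ge0. Qed.

Lemma norm_le_enorm v : `|v| <= enorm v.
Proof.
by rewrite -(@ler_pXn2r _ 2) ?nnegrE ?enorm_ge0 // enorm_sqr sqr_norm_le_dot.
Qed.

Lemma enorm_gt0 v : v != 0 -> 0 < enorm v.
Proof. by rewrite -normr_gt0 => /lt_le_trans; apply; exact: norm_le_enorm. Qed.

End DotProduct.

(** * First-order expansion by the gradient *)

Section Gradient.
Context {R : realType} {n : nat}.
Variables (g : 'rV[R]_n -> R) (x : 'rV[R]_n).
Hypothesis dg : differentiable g x.

Lemma diff_dot_grad (v : 'rV[R]_n) : 'd g x v = dot (grad g x) v.
Proof.
rewrite [in LHS](matrix_sum_delta v) big_ord1 linear_sum; apply: eq_bigr => i _.
by rewrite linearZ mxE deriveE // mulrC.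
Qed.

Lemma grad_expansion (e : R) : 0 < e -> \forall y \near x,
  `|g y - g x - dot (grad g x) (y - x)| <= e * `|y - x|.
Proof.
move=> e0; have /eqaddoP gP := diff_locally dg.
rewrite (near_shift 0 x) subr0; have := gP e e0.
rewrite near_simpl; apply: filterS => y /=.
by rewrite !fctE /= diff_dot_grad opprD addrA addrK.
Qed.

Lemma grad_quotient_cvg (v : 'rV[R]_n) :
  ((g (x + t *: v) - g x) / t) @[t --> 0^'+] --> dot (grad g x) v.
Proof.
rewrite -diff_dot_grad -deriveE //.
have /cvg_dnbhs_at_right := (diff_derivable dg : derivable g x v).
by apply: cvg_trans; apply: near_eq_cvg; near=> t; rewrite /= [x + _]addrC [RHS]mulrC.
Unshelve. all: by end_near. Qed.

End Gradient.

(** * Directional derivative of a finite maximum *)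

Section MaxFunction.
Context {R : realType} {N n : nat}.
Variable f : 'I_N.+1 -> 'rV[R]_n -> R.
Implicit Types x d : 'rV[R]_n.

Lemma Phi_ge j x : f j x <= Phi f x.
Proof. exact: le_bigmax. Qed.

Lemma Phi_active x : exists j, f j x = Phi f x.
Proof.
rewrite /Phi; elim/big_ind: _ => [|a b [i <-] [j <-]|i _]; first by exists ord0.
- by case: (leP (f i x) (f j x)) => _; [exists j|exists i].
- by exists i.
Qed.

(** A piece strictly below the maximum at [x] stays below the midpoint of the gap nearby, while an
    active one stays above it, so no new piece becomes active. *)
Lemma near_active x : (forall j, {for x, continuous (f j)}) ->
  \forall y \near x, forall i, f i y = Phi f y -> f i x = Phi f x.
Proof.
move=> fc; have [j0 fj0] := Phi_active x.
apply: (@filter_forall _ _ _ _ (nbhs_filter x)) => i.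
have := Phi_ge i x.
rewrite le_eqVlt => /predU1P[-> |]; first by near=> y.
rewrite -fj0 => fij.
have mid (a b : R) : a < b -> a < (a + b) / 2 < b by move=> ?; lra.
have /andP[l1 l2] := mid _ _ fij; set m := (_ + _) / 2 in l1 l2.
near=> y => fiy; exfalso.
have : f i y < m by near: y; have := fc i; move/cvgr_lt; apply.
have : m < f j0 y by near: y; have := fc j0; move/cvgr_gt; apply.
by have := Phi_ge j0 y; rewrite -fiy; lra.
Unshelve. all: by end_near. Qed.

(** Danskin's formula. For short steps only pieces active at [x] attain the maximum, so the quotient
    of [Phi f] is squeezed between that of the steepest active piece and the largest of the active
    quotients. This also shows that the limit in [dirder] exists. *)
Lemma dirder_Phi x d : (forall j, differentiable (f j) x) ->
  exists j, [/\ f j x = Phi f x, dirder (Phi f) x d = dot (grad (f j) x) d &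
    forall i, f i x = Phi f x -> dot (grad (f i) x) d <= dot (grad (f j) x) d].
Proof.
move=> df; have [j0 /eqP fj0] := Phi_active x.
have [j /eqP fj jmax] := @arg_maxP _ R _ j0 (fun j => f j x == Phi f x)
  (fun j => dot (grad (f j) x) d) fj0.
exists j; split=> // [|i /eqP]; last exact: jmax.
apply/cvg_lim => //; apply/cvgrPdist_le => e e0.
have xt : (x + t *: d) @[t --> 0^'+] --> x.
  rewrite -[X in _ --> X]addr0 -[X in _ + X](scale0r d).
  apply: cvg_at_right_filter; apply: cvgD; first exact: cvg_cst.
  exact: cvgZr_tmp.
near=> t; have t0 : 0 < t by near: t; exact: nbhs_right_gt.
have [i fi] := Phi_active (x + t *: d).
have fix_ : f i x = Phi f x.
  move: i fi; near: t; apply: (xt _ (near_active x _)) => k.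
  exact: differentiable_continuous.
have qe : forall k, `|dot (grad (f k) x) d - (f k (x + t *: d) - f k x) / t| <= e.
  near: t; apply: (@filter_forall _ _ _ _ (at_right_proper_filter 0)) => k.
  move: e e0; apply/cvgrPdist_le.
  exact: grad_quotient_cvg.
rewrite ler_distlC; apply/andP; split.
  have := qe j; rewrite ler_distlC => /andP[/le_trans+ _]; apply.
  by rewrite ler_pM2r ?invr_gt0 // fj lerB // Phi_ge.
have := qe i; rewrite ler_distlC fi fix_ => /andP[_ /le_trans]; apply.
by rewrite lerD2r; apply: jmax; apply/eqP.
Unshelve. all: by end_near. Qed.

Lemma dirder_Phi_ge x d j : (forall j, differentiable (f j) x) ->
  f j x = Phi f x -> dot (grad (f j) x) d <= dirder (Phi f) x d.
Proof. by move=> /(dirder_Phi x d)[i [_ -> +]]; exact. Qed.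

Lemma dirder_Phi_le x d a : (forall j, differentiable (f j) x) ->
  (forall j, f j x = Phi f x -> dot (grad (f j) x) d <= a) ->
  dirder (Phi f) x d <= a.
Proof. by move=> /(dirder_Phi x d)[i [fi -> _]]; exact. Qed.

Lemma Phi_dist_le x y e : (forall j, `|f j x - f j y| <= e) ->
  `|Phi f x - Phi f y| <= e.
Proof.
move=> fe; have [i fi] := Phi_active x; have [j fj] := Phi_active y.
have := fe i; have := fe j; rewrite !ler_distl.
have := Phi_ge i y; have := Phi_ge j x; lra.
Qed.

End MaxFunction.

(** * Optimality conditions and stability of the quadratic program *)

Section QuadraticProgram.
Context {R : realType} {N n : nat}.
Variable f : 'I_N.+1 -> 'rV[R]_n -> R.
Implicit Types (x p q : 'rV[R]_n) (l m : 'cV[R]_N.+1).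

Definition gcomb x l : 'rV[R]_n := \sum_j l j 0 *: grad (f j) x.

Definition fcomb x l : R := \sum_j l j 0 * f j x.

Lemma gcombE x l : ((Gmat f x)^T *m l)^T = gcomb x l.
Proof.
apply/rowP => i; rewrite !mxE summxE; apply: eq_bigr => j _.
by rewrite !mxE mulrC.
Qed.

Lemma qp_objE x l :
  qp_obj f x l = 2^-1 * dot (gcomb x l) (gcomb x l) - fcomb x l.
Proof.
rewrite /qp_obj; congr (_ * _ - _).
  have -> : l^T *m Gmat f x = gcomb x l by rewrite -gcombE trmx_mul trmxK.
  rewrite -mulmxA mxE; apply: eq_bigr => i _; congr (_ * _).
  by rewrite -gcombE [RHS]mxE.
by rewrite mxE; apply: eq_bigr => j _; rewrite !mxE mulrC.
Qed.

(* Optimality of [l] for the quadratic program, in the dual variable [p]. *)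
Definition kkt x l p : Prop :=
  [/\ in_simplex l, p = - gcomb x l &
      forall j, f j x + dot (grad (f j) x) p <= fcomb x l - dot p p].

Lemma simplex_sum_le l (F : 'I_N.+1 -> R) a :
  in_simplex l -> (forall j, F j <= a) -> \sum_j l j 0 * F j <= a.
Proof.
move=> [l1 l0] Fa; rewrite -[leRHS]mul1r -l1 mulr_suml.
by apply: ler_sum => j _; rewrite ler_wpM2l.
Qed.

Lemma simplex_norm_sum_le l (F : 'I_N.+1 -> R) a :
  in_simplex l -> (forall j, `|F j| <= a) -> `|\sum_j l j 0 * F j| <= a.
Proof.
move=> ls Fa; apply: le_trans (ler_norm_sum _ _ _) _.
under eq_bigr do rewrite normrM ger0_norm ?(ls.2) //.
exact: simplex_sum_le.
Qed.

Lemma norm_gcomb_le x l a : in_simplex l ->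
  (forall j, `|grad (f j) x| <= a) -> `|gcomb x l| <= a.
Proof.
move=> ls ga; apply: le_trans (ler_norm_sum _ _ _) _.
under eq_bigr do rewrite normrZ ger0_norm ?(ls.2) //.
exact: simplex_sum_le.
Qed.

Lemma dot_gcomb x l v : dot (gcomb x l) v = \sum_j l j 0 * dot (grad (f j) x) v.
Proof. by rewrite dot_suml; apply: eq_bigr => j _; rewrite dotZl. Qed.

Lemma quadratic_ge0_slope (a b : R) :
  (forall s, 0 < s -> s <= 1 -> 0 <= s * a + s ^+ 2 * b) -> 0 <= a.
Proof.
move=> h; rewrite leNgt; apply/negP => a0.
have c0 : 0 < `|b| - a by rewrite subr_gt0 (lt_le_trans a0).
(* With this [s], [s * |b| <= - a / 2], so the linear term dominates; the [- a] in the denominator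
   keeps it positive when [b = 0] and ensures [s <= 1]. *)
pose s := - a / (2 * (`|b| - a)).
have s0 : 0 < s by rewrite divr_gt0 ?oppr_gt0 ?mulr_gt0.
have sE : s * (2 * (`|b| - a)) = - a by rewrite mulfVK // gt_eqF ?mulr_gt0.
have s1 : s <= 1.
  rewrite /s ler_pdivrMr ?mulr_gt0 // mul1r; have := normr_ge0 b; lra.
have := h s s0 s1; rewrite expr2 -mulrA -mulrDr pmulr_rge0 //.
have : s * b <= s * `|b| by rewrite ler_pM2l // ler_norm.
nra.
Qed.

(* First-order optimality along the segments from [l] to the vertices. *)
Lemma qp_kkt x l : in_simplex l ->
  (forall m, in_simplex m -> qp_obj f x l <= qp_obj f x m) ->
  kkt x l (- gcomb x l).
Proof.
move=> ls lmin; split=> // j; set g := gcomb x l.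
rewrite dotNr dotNl dotNr opprK -subr_ge0.
(* On the segment from [l] to vertex [j], the linear coefficient of the objective is the slack of
   the [j]-th condition, and this is the quadratic one. *)
apply: (@quadratic_ge0_slope _ (2^-1 * dot (grad (f j) x - g) (grad (f j) x - g))).
move=> s s0 s1.
pose m := (1 - s) *: l + s *: delta_mx j 0 : 'cV[R]_N.+1.
(* Stated over any module, so that one identity serves the gradients, the values and the total
   weight. *)
have msum (V : lmodType R) (F : 'I_N.+1 -> V) :
    \sum_i m i 0 *: F i = (1 - s) *: (\sum_i l i 0 *: F i) + s *: F j.
  under eq_bigr do rewrite !mxE eqxx andbT scalerDl -!scalerA.
  rewrite big_split /= -!scaler_sumr; congr (_ + _ *: _).
  rewrite (bigD1 j) //= eqxx scale1r big1 ?addr0 // => i /negPf ->.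
  by rewrite scale0r.
have msimplex : in_simplex m.
  split=> [|i].
    have := msum R^o (fun=> 1); rewrite /GRing.scale /=.
    under eq_bigr do rewrite mulr1. move=> ->.
    under eq_bigr do rewrite mulr1. rewrite ls.1; ring.
  rewrite !mxE eqxx andbT addr_ge0 // mulr_ge0 ?ler0n ?(ls.2) //; lra.
have := lmin m msimplex; rewrite !qp_objE.
have -> : gcomb x m = g + s *: (grad (f j) x - g).
  rewrite /gcomb msum -/(gcomb x l) -/g scalerBl scale1r scalerBr.
  by rewrite addrAC addrA.
have -> : fcomb x m = (1 - s) * fcomb x l + s * f j x.
  exact: (msum R^o (fun i => f i x)).
rewrite -/g !(dotDl, dotDr, dotZl, dotZr, dotNl, dotNr).
rewrite (dotC g (grad _ _)); nra.
Qed.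

(* Strong convexity in [p]: test the conditions at [x] with the multipliers of
   [y], those at [y] with the multipliers of [x], and add. *)
Lemma kkt_dist x y l m p q (e B : R) : kkt x l p -> kkt y m q ->
  0 <= e -> (forall j, `|f j x - f j y| <= e) ->
  (forall j, `|grad (f j) x - grad (f j) y| <= e) ->
  `|p| <= B -> `|q| <= B ->
  `|p - q| ^+ 2 <= 2 * e + 2 * (n.+1%:R * e * B).
Proof.
move=> [ls pE kp] [ms qE kq] e0 fe ge pB qB.
apply: le_trans (sqr_norm_le_dot _) _.
have combD (k : 'cV[R]_N.+1) z (F : 'I_N.+1 -> R) :
    \sum_j k j 0 * (f j z + F j) = fcomb z k + \sum_j k j 0 * F j.
  by rewrite -big_split; apply: eq_bigr => j _; rewrite mulrDr.
have := simplex_sum_le _ _ _ ms kp; have := simplex_sum_le _ _ _ ls kq.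
rewrite !combD => hy hx.
(* The multipliers [m] combine the gradients at [y] to [- q]; moving from [x] to [y] leaves only a
   gradient difference to estimate. *)
have gx : \sum_j m j 0 * dot (grad (f j) x) p = - dot q p +
    \sum_j m j 0 * dot (grad (f j) x - grad (f j) y) p.
  rewrite qE dotNl dot_gcomb opprK -big_split; apply: eq_bigr => j _ /=.
  by rewrite dotBl; ring.
have gy : \sum_j l j 0 * dot (grad (f j) y) q = - dot p q +
    \sum_j l j 0 * dot (grad (f j) y - grad (f j) x) q.
  rewrite pE dotNl dot_gcomb opprK -big_split; apply: eq_bigr => j _ /=.
  by rewrite dotBl; ring.
have dB (u v : 'rV[R]_n) : `|u| <= e -> `|v| <= B -> `|dot u v| <= n.+1%:R * e * B.
  move=> ue vB; apply: le_trans (norm_dot_le _ _) _.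
  by apply: ler_pM => //; rewrite ler_wpM2l.
have combB (k : 'cV[R]_N.+1) : \sum_j k j 0 * (f j x - f j y) = fcomb x k - fcomb y k.
  by rewrite -sumrB; apply: eq_bigr => j _; rewrite mulrBr.
have := simplex_norm_sum_le m _ _ ms fe; have := simplex_norm_sum_le l _ _ ls fe.
have := simplex_norm_sum_le m _ _ ms (fun j => dB _ _ (ge j) pB).
have gey j : `|grad (f j) y - grad (f j) x| <= e by rewrite distrC.
have := simplex_norm_sum_le l _ _ ls (fun j => dB _ _ (gey j) qB).
rewrite !ler_norml !combB => hl hm fl fm.
(* On adding [hx] and [hy] the dot products form [dot (p - q) (p - q)]; the values cost [2 * e] and
   the gradients [2 * (n.+1%:R * e * B)]. *)
rewrite dotBr !dotBl (dotC p q) in hx hy gx gy *; lra.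
Qed.

End QuadraticProgram.

(** * The Armijo step in terms of the unnormalised direction *)

Section LineSearch.
Context {R : realType} {N n : nat}.
Variable f : 'I_N.+1 -> 'rV[R]_n -> R.
Hypothesis df : forall j y, differentiable (f j) y.
Implicit Types (x y p d : 'rV[R]_n) (l : 'cV[R]_N.+1).

(** The first power of one half that is at most [t] has a predecessor, since [t < 1], and that
    predecessor lies in the required range. *)
Lemma dyadic_between (t : R) : 0 < t -> t < 1 ->
  exists i : nat, t < 2^-1 ^+ i <= 2 * t.
Proof.
move=> t0 t1.
have ex : exists i : nat, (2^-1 : R) ^+ i <= t.
  have := @cvg_geometric R 1 2^-1.
  rewrite ger0_norm // invf_lt1 // ltr1n => /(_ isT) /cvgr_le /(_ t t0).
  by move=> [i _ /(_ i (leqnn i))] /=; rewrite mul1r; exists i.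
case: (ex_minnP ex) => -[|i]; first by rewrite expr0 leNgt t1.
move=> it imin; exists i; apply/andP; split.
  by rewrite ltNge; apply/negP => /imin; rewrite ltnn.
by move: it; rewrite exprS; lra.
Qed.

(* One iteration along the unnormalised direction [p], with step [b] and
   [D] the directional derivative of [Phi f] at [x] along [p].  The last field
   is what minimality of the backtracking exponent gives: any bound [r] on the
   step has a rejected trial step within a factor [2] above it.  The case
   [p = 0] is covered with [b = D = 0]. *)
Record iteration x y l p (b D : R) : Prop := Iteration {
  iter_kkt : kkt f x l p;
  iter_next : y = x + b *: p;
  iter_ge0 : 0 <= b;
  iter_gt0 : p != 0 -> 0 < b;
  iter_active : forall j, f j x = Phi f x -> dot (grad (f j) x) p <= D;
  iter_slope : D <= - dot p p;
  iter_descent : Phi f y <= Phi f x + b / 2 * D;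
  iter_rejected : p != 0 -> forall r, b <= r -> r * enorm p < 1 ->
    exists t, [/\ r < t, t <= 2 * r & Phi f x + t / 2 * D <= Phi f (x + t *: p)]
}.

Lemma algorithmX_iteration (x : nat -> 'rV[R]_n) : algorithmX f x ->
  forall k, exists l p b D, iteration (x k) (x k.+1) l p b D.
Proof.
move=> [_ alg] k; have [l [ls [lmin]]] := alg k.
rewrite gcombE /=; have := qp_kkt f (x k) l ls lmin.
move: (- gcomb _ _ _) => p pkkt step; exists l, p.
move: step; have [p0|p0] := eqVneq p 0; move=> step.
  have := step.1 erefl; rewrite scaler0 addr0 => xk; exists 0, 0; split=> //.
  - by rewrite scale0r addr0.
  - by rewrite p0 eqxx.
  - by move=> j _; rewrite p0 dot0r.
  - by rewrite p0 dot0r oppr0.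
  - by rewrite xk mulr0 addr0.
  - by rewrite p0 eqxx.
set e := enorm p; set d := e^-1 *: p; set D := dirder _ _ _ in step.
have e0 : 0 < e by exact: enorm_gt0.
have pd : p = e *: d by rewrite scalerA mulfV ?gt_eqF // scale1r.
have d0 : d <> 0 by move=> d0; move: p0; rewrite pd d0 scaler0 eqxx.
have [i [armi [nearm xk]]] := step.2 d0.
have scalE s : s *: d = (s / e) *: p by rewrite scalerA.
(* Passing from the unit vector [d] to [p = e *: d] divides the step by [e] and multiplies the slope
   by [e]. *)
exists (2^-1 ^+ i / e), (e * D).
have e1 s : s / e / 2 * (e * D) = 2^-1 * s * D by field; rewrite gt_eqF.
split=> //.
- by rewrite xk scalE.
- by rewrite divr_ge0 ?exprn_ge0 ?ltW.
- by move=> _; rewrite divr_gt0 ?exprn_gt0.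
- move=> j jact; rewrite pd dotZr ler_pM2l //; exact: dirder_Phi_ge.
(* At an active piece [f j] equals [Phi f], which bounds [fcomb], so the optimality condition leaves
   a slope along [p] of at most [- dot p p]. *)
- have -> : - dot p p = e * (- e) by rewrite -enorm_sqr -/e; ring.
  rewrite ler_pM2l //; apply: dirder_Phi_le => // j jact.
  rewrite dotZr ler_pdivrMl //.
  have [_ _ /(_ j)] := pkkt; rewrite jact.
  have := simplex_sum_le l (fun j => f j (x k)) _ ls (fun j => Phi_ge f j (x k)).
  rewrite -/(fcomb _ _ _) -enorm_sqr -/e; lra.
- by rewrite e1 xk ltW.
- move=> _ r br re.
  have r0 : 0 < r by rewrite (lt_le_trans _ br) // divr_gt0 ?exprn_gt0.
  (* The longest trial step is [1], whence the assumption on [r * e]. Were trial [m] accepted,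
     minimality would give [i <= m], and the chosen step would exceed [r]. *)
  have [m /andP[m1 m2]] := dyadic_between (r * e) (mulr_gt0 r0 e0) re.
  exists (2^-1 ^+ m / e); split.
  + by rewrite ltr_pdivlMr.
  + by rewrite ler_pdivrMr // -mulrA.
  + rewrite leNgt e1 -scalE; apply/negP => /nearm.
    apply; rewrite ltnNge; apply/negP => im.
    move: br; rewrite ler_pdivrMr // leNgt => /negP; apply.
    by rewrite (lt_le_trans m1) // ler_wiXn2l // invf_le1 // ler1n.
Qed.

End LineSearch.

Arguments iter_kkt {R N n f x y l p b D} _.
Arguments iter_next {R N n f x y l p b D} _.
Arguments iter_ge0 {R N n f x y l p b D} _.
Arguments iter_gt0 {R N n f x y l p b D} _.
Arguments iter_active {R N n f x y l p b D} _.
Arguments iter_slope {R N n f x y l p b D} _.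
Arguments iter_descent {R N n f x y l p b D} _.
Arguments iter_rejected {R N n f x y l p b D} _.

(** * Lower bound for the search direction at a non-stationary point *)

Section NonStationary.
Context {R : realType} {N n : nat}.
Variable f : 'I_N.+1 -> 'rV[R]_n -> R.
Implicit Types (x y p d : 'rV[R]_n) (l : 'cV[R]_N.+1).

(** Weighting the linearised decrease by [l] gives [fcomb f x l <= Phi f x - b + s * dot p d], while
    the optimality condition at an active piece bounds [fcomb f x l] below by [Phi f x] up to a
    multiple of [|p|]. *)
Lemma kkt_lower_bound x l p d (s b B : R) : kkt f x l p -> 0 <= s ->
  (forall j, f j x + s * dot (grad (f j) x) d <= Phi f x - b) ->
  (forall j, `|grad (f j) x| <= B) ->
  b <= n.+1%:R * (s * `|d| + B) * `|p|.
Proof.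
move=> [ls pE kp] s0 fd gB; have [j fj] := Phi_active f x.
have := kp j; have := simplex_sum_le l _ _ ls fd.
have -> : \sum_j l j 0 * (f j x + s * dot (grad (f j) x) d) =
    fcomb f x l - s * dot p d.
  rewrite pE dotNl dot_gcomb mulrN opprK mulr_sumr -big_split.
  by apply: eq_bigr => i _ /=; ring.
rewrite fj => h1 h2.
have := norm_dot_le p d; have := norm_dot_le (grad (f j) x) p.
rewrite !ler_norml => /andP[h3 _] /andP[_ /(ler_wpM2l s0) h4].
have h5 : n.+1%:R * `|grad (f j) x| * `|p| <= n.+1%:R * B * `|p|.
  by rewrite ler_wpM2r // ler_wpM2l.
have := dot_ge0 p; lra.
Qed.

(** Active pieces have negative slope along [d], so any [s > 0] serves them; each inactive piece has
    a positive gap, which a small [s] does not close. *)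
Lemma descent_linearised x d : (forall j, differentiable (f j) x) ->
  dirder (Phi f) x d < 0 ->
  exists2 s : R, 0 < s & forall j, f j x + s * dot (grad (f j) x) d < Phi f x.
Proof.
move=> df dd; near (0 : R)^'+ => s.
have s0 : 0 < s by near: s; exact: nbhs_right_gt.
exists s => //; near: s.
apply: (@filter_forall _ _ _ _ (at_right_proper_filter 0)) => j.
have := Phi_ge f j x; rewrite le_eqVlt => /predU1P[fj|fj].
  near=> s; have s0 : 0 < s by near: s; exact: nbhs_right_gt.
  rewrite fj gtrDl pmulr_rlt0 //.
  by rewrite (le_lt_trans _ dd) // dirder_Phi_ge.
set g := dot _ _; pose c := (Phi f x - f j x) / (`|g| + 1).
have g1 : 0 < `|g| + 1 by rewrite ltr_wpDl.
have c0 : 0 < c by rewrite divr_gt0 // subr_gt0.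
near=> s; have s0 : 0 < s by near: s; exact: nbhs_right_gt.
have sc : s < c by near: s; exact: nbhs_right_lt.
rewrite -ltrBrDl; apply: (@le_lt_trans _ _ (s * (`|g| + 1))).
  by rewrite ler_pM2l // (le_trans (ler_norm _)) // lerDl.
by rewrite -ltr_pdivlMr.
Unshelve. all: by end_near. Qed.

End NonStationary.

(** * Local analysis at the accumulation point *)

Section AccumulationPoint.
Context {R : realType} {N n : nat}.
Variable f : 'I_N.+1 -> 'rV[R]_n -> R.
Variable xb : 'rV[R]_n.
Hypothesis df : forall j y, differentiable (f j) y.
Hypothesis gc : forall j, continuous (grad (f j)).
Implicit Types (x y p q d : 'rV[R]_n) (l : 'cV[R]_N.+1).

Lemma near_values_grads (e : R) : 0 < e -> \forall x \near xb, forall j,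
  `|f j x - f j xb| <= e /\ `|grad (f j) x - grad (f j) xb| <= e.
Proof.
move=> e0; apply: (@filter_forall _ _ _ _ (nbhs_filter xb)) => j.
near=> x; split; rewrite distrC; near: x.
  have := differentiable_continuous (df j xb).
  by move/cvgr_dist_le; apply.
by have := gc j xb; move/cvgr_dist_le; apply.
Unshelve. all: by end_near. Qed.

(** Some [s] gives every piece a linearised decrease at [xb], the smallest being [b]; by continuity
    [b / 2] survives nearby, where [kkt_lower_bound] applies. *)
Lemma near_kkt_norm_ge d : dirder (Phi f) xb d < 0 ->
  exists2 h : R, 0 < h &
    \forall x \near xb, forall l p, kkt f x l p -> h <= `|p|.
Proof.
move=> dd; have [s s0 hs] := descent_linearised f xb d (df ^~ xb) dd.
have [j0 _ jmin] := @arg_minP _ R _ ord0 predT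
  (fun j => Phi f xb - (f j xb + s * dot (grad (f j) xb) d)) isT.
set b := _ - _ in jmin.
have b0 : 0 < b by rewrite subr_gt0.
pose G : R := \big[Num.max/0]_j `|grad (f j) xb|.
have G0 j : `|grad (f j) xb| <= G by exact: le_bigmax.
have G0' : 0 <= G by exact: le_trans (G0 ord0).
pose K := n.+1%:R * (s * `|d| + (G + 1)).
have K0 : 0 < K by rewrite mulr_gt0 // ltr_wpDl ?mulr_ge0 ?(ltW s0) // ltr_wpDl.
(* Moving from [xb] to [x] changes [f j] and [Phi f] by at most [e] each and the scaled slope by at
   most [s * (n.+1%:R * e * |d|)]; together this is at most [b / 2]. The bound [1] keeps the
   gradients within [G + 1]. *)
pose e := Num.min 1 (b / (2 * (2 + s * (n.+1%:R * `|d|)))).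
have c0 : 0 < 2 * (2 + s * (n.+1%:R * `|d|)).
  by rewrite mulr_gt0 // ltr_pwDl // !mulr_ge0 // ltW.
have e0 : 0 < e by rewrite lt_min ltr01 divr_gt0.
exists (b / 2 / K); first by rewrite !divr_gt0.
near=> x => l p xk.
have fx : forall j, `|f j x - f j xb| <= e /\ `|grad (f j) x - grad (f j) xb| <= e.
  by near: x; exact: near_values_grads.
have eb : e * (2 * (2 + s * (n.+1%:R * `|d|))) <= b.
  by rewrite -ler_pdivlMr // ge_min lexx orbT.
rewrite ler_pdivrMr // [leRHS]mulrC.
apply: (kkt_lower_bound f x l p d s _ _ xk (ltW s0)) => j.
- have [fj gj] := fx j.
  have := Phi_dist_le f x xb e (fun j => (fx j).1).
  have := norm_dot_le (grad (f j) x - grad (f j) xb) d.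
  have h1 : n.+1%:R * `|grad (f j) x - grad (f j) xb| * `|d| <= n.+1%:R * e * `|d|.
    by rewrite ler_wpM2r // ler_wpM2l.
  move: fj; rewrite dotBl !ler_norml => fj h2 h3.
  have /andP[_ h4] := h2.
  have := ler_wpM2l (ltW s0) (le_trans h4 h1).
  have := jmin j isT; rewrite -/b; lra.
- have [_ gj] := fx j.
  have e1 : e <= 1 by rewrite ge_min lexx.
  have := ler_normD (grad (f j) x - grad (f j) xb) (grad (f j) xb).
  rewrite subrK; have := G0 j; lra.
Unshelve. all: by end_near. Qed.

(* In the scaled model, [Phi f] has slope [- a] up to [xb] and at most [- b]
   beyond it, where [a] and [b] are the extreme slopes of the pieces active at
   [xb]; trial steps overshooting [xb] by at most a factor [2] are accepted. *)
Lemma rejected_slope_small x p q (r t e b B D : R) :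
  1 <= B -> 0 < e -> e <= 1 -> 0 < r -> r <= t -> t <= 2 * r ->
  (forall j, `|grad (f j) xb| <= B) -> `|p| <= B -> `|q| <= B ->
  `|p - q| <= e -> `|x - xb + r *: q| <= e * r ->
  (forall y, y = x \/ y = x + t *: p -> forall j,
    `|f j y - f j xb - dot (grad (f j) xb) (y - xb)| <= e * `|y - xb| /\
    (f j y = Phi f y -> f j xb = Phi f xb)) ->
  (forall j, `|grad (f j) x - grad (f j) xb| <= e) ->
  (forall j, f j x = Phi f x -> dot (grad (f j) x) p <= D) ->
  (forall j, f j xb = Phi f xb -> dot (grad (f j) xb) q <= - b) ->
  Phi f x + t / 2 * D <= Phi f (x + t *: p) ->
  b <= 24 * (n.+1%:R * B * e).
Proof.
move=> B1 e0 e1 r0 rt t2r gB pB qB pq xq exp gx act slope rej.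
set K : R := n.+1%:R.
have K1 : 1 <= K by rewrite ler1n.
have B0 : 0 < B by exact: lt_le_trans B1.
have dB (u v : 'rV[R]_n) (a c : R) : `|u| <= a -> `|v| <= c -> `|dot u v| <= K * a * c.
  move=> ua vc; apply: le_trans (norm_dot_le _ _) _.
  by apply: ler_pM => //; rewrite ler_wpM2l.
have KBe : B * e <= K * B * e by rewrite -mulrA ler_peMl // mulr_ge0 // ltW.
have [j0 fj0] := Phi_active f xb.
(* The active piece falling fastest along [q] dominates on the approach side of [xb]; here [a] is
   its signed, hence smallest, slope. *)
have [j /eqP fj jmin] := @arg_minP _ R _ j0 (fun j => f j xb == Phi f xb)
  (fun j => dot (grad (f j) xb) q) (introT eqP fj0).
set a := dot _ q in jmin.
have t0 : 0 < t by exact: lt_le_trans rt.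
have xbd : `|x - xb| <= 2 * B * r.
  rewrite -[x - xb](addrK (r *: q)).
  apply: le_trans (ler_normB _ _) _; rewrite normrZ gtr0_norm //.
  have : r * `|q| <= r * B by rewrite ler_pM2l.
  have : e * r <= B * r by rewrite ler_pM2r // (le_trans e1).
  lra.
have PhiX : Phi f xb - r * a - 3 * (K * B * e) * r <= Phi f x.
  apply: le_trans (Phi_ge f j x).
  have [+ _] := exp x (or_introl erefl) j.
  have -> : dot (grad (f j) xb) (x - xb) =
      dot (grad (f j) xb) (x - xb + r *: q) - r * a.
    by rewrite [in RHS]dotDr dotZr addrK.
  have := dB _ _ _ _ (gB j) xq.
  have : e * `|x - xb| <= e * (2 * B * r) by rewrite ler_pM2l.
  have := ler_wpM2r (ltW r0) KBe.
  rewrite fj !ler_norml; lra.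
have DX : a - 2 * (K * B * e) <= D.
  have [i fi] := Phi_active f x.
  apply: le_trans (act i fi).
  have [_ /(_ fi)/eqP/jmin ai] := exp x (or_introl erefl) i.
  have := dB _ _ _ _ (gx i) pB; have := dB _ _ _ _ (gB i) pq.
  rewrite dotBl dotBr !ler_norml; lra.
have [i fi] := Phi_active f (x + t *: p).
have [expi /(_ fi) iact] := exp (x + t *: p) (or_intror erefl) i.
have yE : x + t *: p - xb = (t - r) *: q + ((x - xb + r *: q) + t *: (p - q)).
  by rewrite scalerBl scalerBr; apply/rowP => k; rewrite !mxE; ring.
have err : `|(x - xb + r *: q) + t *: (p - q)| <= 3 * e * r.
  apply: le_trans (ler_normD _ _) _; rewrite normrZ gtr0_norm //.
  have : t * `|p - q| <= t * e by rewrite ler_pM2l.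
  have : t * e <= 2 * r * e by rewrite ler_pM2r.
  lra.
have ybd : `|x + t *: p - xb| <= 4 * B * r.
  rewrite yE; apply: le_trans (ler_normD _ _) _.
  rewrite normrZ ger0_norm ?subr_ge0 //.
  have : (t - r) * `|q| <= (t - r) * B by rewrite ler_wpM2l ?subr_ge0.
  have : (t - r) * B <= r * B by rewrite ler_pM2r //; lra.
  have : e * r <= B * r by rewrite ler_pM2r // (le_trans e1).
  lra.
(* Past [xb] only the overshoot [t - r] counts, with the slope of the piece attaining the maximum at
   the trial point. *)
have PhiY : Phi f (x + t *: p) <=
    Phi f xb + (t - r) * dot (grad (f i) xb) q + 7 * (K * B * e) * r.
  rewrite -fi -iact; move: expi; rewrite yE dotDr dotZr -yE.
  have := dB _ _ _ _ (gB i) err.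
  have : e * `|x + t *: p - xb| <= e * (4 * B * r) by rewrite ler_pM2l.
  have := ler_wpM2r (ltW r0) KBe.
  rewrite !ler_norml; lra.
have := slope i iact; have := slope j fj; rewrite -/a => sa si.
have si' : (t - r) * dot (grad (f i) xb) q <= (t - r) * - b.
  by rewrite ler_wpM2l ?subr_ge0.
(* The factor is nonnegative because [t <= 2 * r]. The coefficients [r - t / 2] and [t - r] of [b]
   add up to [t / 2], and the errors [3], [7] and [2] to [12]. *)
have sa' : (r - t / 2) * a <= (r - t / 2) * - b by rewrite ler_wpM2l //; lra.
have DX' : t / 2 * (a - 2 * (K * B * e)) <= t / 2 * D by rewrite ler_pM2l //; lra.
have KBe0 : 0 < K * B * e by rewrite !mulr_gt0.
have tKBe : t * (K * B * e) <= 2 * r * (K * B * e) by rewrite ler_pM2r.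
have main : t / 2 * b <= r * (12 * (K * B * e)) by lra.
have [b0|b0] := leP b 0; first by rewrite (le_trans b0) // mulr_ge0 // ltW.
have rtb : r * b <= t * b by rewrite ler_pM2r.
rewrite -(ler_pM2l r0); lra.
Qed.

(* If the increments point almost along [q] and have finite total length, then
   the limit is approached along [- q]; [r] is the remaining length. *)
Lemma finite_length_tail (y P : nat -> 'rV[R]_n) (b : nat -> R) q (e C : R) :
  (forall i, y i.+1 = y i + b i *: P i) -> (forall i, 0 <= b i) ->
  (forall i, `|P i - q| <= e) -> (forall i, \sum_(k < i) b k <= C) ->
  (forall (u : R) m, 0 < u -> exists2 k, (m <= k)%N & `|y k - xb| < u) ->
  exists r : nat -> R, [/\ forall i, b i <= r i,
    forall u, 0 < u -> exists i, r i < u &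
    forall i, `|y i - xb + r i *: q| <= e * r i].
Proof.
move=> yS b0 Pq SC acc; pose S i := \sum_(k < i) b k.
have SS i : S i.+1 = S i + b i by rewrite /S big_ord_recr.
have Sincr i k : S i <= S (i + k)%N.
  elim: k => [|k IH]; first by rewrite addn0.
  by rewrite addnS SS (le_trans IH) // lerDl.
have Ssup : has_sup (range S).
  by split; [exists (S 0%N), 0%N|exists C => _ [i _ <-]; exact: SC].
pose s := sup (range S).
have Ss i : S i <= s by apply: sup_upper_bound => //; exists i.
have sS u : 0 < u -> exists i, s - S i < u.
  move=> u0; have [_ [i _ <-] si] := sup_adherent u0 Ssup; exists i.
  by rewrite -/s in si; lra.
exists (fun i => s - S i); split=> // [i|i].
  by have := Ss i.+1; rewrite SS; lra.
(* Each step deviates from direction [q] by at most [e * b], and these errors add up. The limit is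
   then taken along indices [m] with [y m] near [xb] and [S m] near [s]. *)
have chain k : `|y i - y (i + k)%N + (S (i + k)%N - S i) *: q|
    <= e * (S (i + k)%N - S i).
  elim: k => [|k IH]; first by rewrite addn0 !subrr scale0r addr0 normr0 mulr0.
  rewrite addnS yS SS.
  set m := (i + k)%N in IH *.
  have -> : y i - (y m + b m *: P m) + (S m + b m - S i) *: q =
    (y i - y m + (S m - S i) *: q) - b m *: (P m - q).
    by apply/rowP => c; rewrite !mxE; ring.
  apply: le_trans (ler_normB _ _) _; rewrite normrZ ger0_norm //.
  have := ler_wpM2l (b0 m) (Pq m); lra.
apply/ler_addgt0Pr => u u0.
have q1 : 0 < 1 + `|q| by rewrite ltr_pwDl.
have e0 : 0 <= e by exact: le_trans (Pq 0%N).
(* As a tolerance for both [|y m - xb|] and [s - S m], this makes the total error [u]. *)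
have v0 : 0 < u / (1 + `|q|) by rewrite divr_gt0.
have [m0 hm0] := sS _ v0; have [m mm ym] := acc _ (maxn i m0) v0.
have im : (i <= m)%N by rewrite (leq_trans _ mm) // leq_maxl.
have m0m : (m0 <= m)%N by rewrite (leq_trans _ mm) // leq_maxr.
have Sm : s - S m < u / (1 + `|q|).
  by have := Sincr m0 (m - m0)%N; rewrite subnKC //; lra.
have := chain (m - i)%N; rewrite subnKC // => ch.
have -> : y i - xb + (s - S i) *: q =
  (y i - y m + (S m - S i) *: q) + ((y m - xb) + (s - S m) *: q).
  by apply/rowP => c; rewrite !mxE; ring.
apply: le_trans (ler_normD _ _) _; apply: lerD.
  by apply: le_trans ch _; rewrite ler_wpM2l // lerB.
apply: le_trans (ler_normD _ _) _.
rewrite normrZ ger0_norm ?subr_ge0 //.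
have -> : u = u / (1 + `|q|) + u / (1 + `|q|) * `|q|.
  by rewrite -[X in X + _]mulr1 -mulrDr divfK ?gt_eqF.
by apply: lerD; [exact: ltW|rewrite ler_wpM2r // ltW].
Qed.

End AccumulationPoint.

(** * Trapping of the iterates and the final contradiction *)

Section Iterates.
Context {R : realType} {N n : nat}.
Variable f : 'I_N.+1 -> 'rV[R]_n -> R.
Variables (xb : 'rV[R]_n) (x P : nat -> 'rV[R]_n).
Variables (L : nat -> 'cV[R]_N.+1) (b D : nat -> R).
Hypothesis xiter : forall k, iteration f (x k) (x k.+1) (L k) (P k) (b k) (D k).
Hypothesis xacc : forall (U : set 'rV[R]_n) m, nbhs xb U ->
  exists2 k, (m <= k)%N & U (x k).
Hypothesis df : forall j y, differentiable (f j) y.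
Hypothesis gc : forall j, continuous (grad (f j)).

Lemma iterate_decrease k :
  b k / 2 * `|P k| ^+ 2 <= Phi f (x k) - Phi f (x k.+1).
Proof.
have b0 : 0 <= b k / 2 by rewrite divr_ge0 // (iter_ge0 (xiter k)).
have := ler_wpM2l b0 (sqr_norm_le_dot (P k)).
have := ler_wpM2l b0 (iter_slope (xiter k)).
have := iter_descent (xiter k); lra.
Qed.

Lemma Phi_iterate_noninc k i : Phi f (x (k + i)%N) <= Phi f (x k).
Proof.
elim: i => [|i IH]; first by rewrite addn0.
rewrite addnS (le_trans _ IH) // -subr_ge0 (le_trans _ (iterate_decrease _)) //.
by rewrite mulr_ge0 ?divr_ge0 ?sqr_ge0 // (iter_ge0 (xiter _)).
Qed.

(** Some later iterate is near [xb], so its value is near [Phi f xb], and values do not increase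
    along the sequence. *)
Lemma Phi_iterate_ge k : Phi f xb <= Phi f (x k).
Proof.
apply/ler_addgt0Pr => e e0.
have [m km fm] := xacc _ k (near_values_grads f xb df gc e e0).
have := Phi_dist_le f (x m) xb e (fun j => (fm j).1).
have := Phi_iterate_noninc k (m - k)%N; rewrite subnKC // ler_norml; lra.
Qed.

(* The decrease of [Phi f] bounds the length of the path, so the iterates cannot
   leave a neighbourhood of [xb] entered late enough. *)
Lemma iterates_trapped (h dl : R) k0 : 0 < h ->
  (forall k, `|x k - xb| < dl -> h <= `|P k|) ->
  `|x k0 - xb| < dl / 2 -> Phi f (x k0) - Phi f xb < h * dl / 4 ->
  forall i, `|x (k0 + i)%N - xb| < dl /\
    \sum_(k < i) b (k0 + k)%N <= (Phi f (x k0) - Phi f xb) / (h ^+ 2 / 2).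
Proof.
move=> h0 hP k0d k0P.
have h20 : 0 < h ^+ 2 / 2 by rewrite divr_gt0 ?exprn_gt0.
(* While [|P| >= h], a step of size [b] lowers [Phi f] by at least [h / 2] times the distance moved
   and [h ^+ 2 / 2] times [b]. The total drop is below [h * dl / 4], so the displacement stays below
   [dl / 2]. *)
have claim i : `|x (k0 + i)%N - x k0| * (h / 2) <= Phi f (x k0) - Phi f (x (k0 + i)%N)
    /\ (\sum_(k < i) b (k0 + k)%N) * (h ^+ 2 / 2)
       <= Phi f (x k0) - Phi f (x (k0 + i)%N).
  elim: i => [|i [IH1 IH2]].
    by rewrite addn0 !subrr normr0 mul0r big_ord0 mul0r.
  have hi : h <= `|P (k0 + i)%N|.
    apply: hP.
    have := ler_normD (x (k0 + i)%N - x k0) (x k0 - xb); rewrite subrKA.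
    have := Phi_iterate_ge (k0 + i)%N.
    have h2 : 0 < h / 2 by rewrite divr_gt0.
    rewrite -(ltr_pM2r h2); nra.
  have bi0 := iter_ge0 (xiter (k0 + i)%N).
  have dec := iterate_decrease (k0 + i)%N.
  have next := iter_next (xiter (k0 + i)%N).
  rewrite addnS big_ord_recr /=; split.
    have -> : x (k0 + i).+1 - x k0 = x (k0 + i)%N - x k0 + b (k0 + i)%N *: P (k0 + i)%N.
      by rewrite next addrAC.
    have := ler_normD (x (k0 + i)%N - x k0) (b (k0 + i)%N *: P (k0 + i)%N).
    rewrite normrZ ger0_norm //; move: (`|_ + _|) => u.
    have := ler_wpM2l (mulr_ge0 bi0 (normr_ge0 (P (k0 + i)%N))) hi.
    have h2 : 0 < h / 2 by rewrite divr_gt0.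
    move=> ? /(ler_wpM2r (ltW h2)); lra.
  have : h ^+ 2 <= `|P (k0 + i)%N| ^+ 2 by rewrite ler_pXn2r ?nnegrE // ltW.
  move=> /(ler_wpM2l bi0); lra.
move=> i; have [c1 c2] := claim i; have ge := Phi_iterate_ge (k0 + i)%N; split.
  have := ler_normD (x (k0 + i)%N - x k0) (x k0 - xb); rewrite subrKA.
  have h2 : 0 < h / 2 by rewrite divr_gt0.
  rewrite -(ltr_pM2r h2); nra.
by rewrite ler_pdivlMr // (le_trans c2) // lerB.
Qed.

Lemma accumulation_dirder_ge0 d : 0 <= dirder (Phi f) xb d.
Proof.
rewrite leNgt; apply/negP => dd.
have [h h0 near_h] := near_kkt_norm_ge f xb df gc d dd.
pose B : R := \big[Num.max/0]_j `|grad (f j) xb| + 1.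
have gbB j : `|grad (f j) xb| <= B - 1 by rewrite addrK; exact: le_bigmax.
have B1 : 1 <= B by have := le_trans (normr_ge0 _) (gbB ord0); lra.
have B0 : 0 < B by exact: lt_le_trans B1.
pose K : R := n.+1%:R; have K1 : 1 <= K by rewrite ler1n.
have KB1 : 1 <= K * B by rewrite mulr_ege1.
have KB0 : 0 < K * B by exact: lt_le_trans KB1.
(* The final estimate reads [h ^+ 2 <= 27 * (K * B * e)]; the factor [28] contradicts it. *)
pose e := Num.min 1 (h ^+ 2 / (28 * (K * B))).
have e0 : 0 < e by rewrite lt_min ltr01 divr_gt0 ?exprn_gt0 ?mulr_gt0.
have e1 : e <= 1 by rewrite ge_min lexx.
have eh : e * (28 * (K * B)) <= h ^+ 2.
  by rewrite -ler_pdivlMr ?mulr_gt0 // ge_min lexx orbT.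
(* Two points near [xb] differ by [2 * e'] in values and gradients, so [kkt_dist] bounds the squared
   distance of their directions by [8 * (K * B) * e'], hence by [e ^+ 2]. *)
pose e' := Num.min e (e ^+ 2 / (8 * (K * B))).
have e'0 : 0 < e' by rewrite lt_min e0 divr_gt0 ?exprn_gt0 ?mulr_gt0.
have e'e : e' <= e by rewrite ge_min lexx.
have e'8 : e' * (8 * (K * B)) <= e ^+ 2.
  by rewrite -ler_pdivlMr ?mulr_gt0 // ge_min lexx orbT.
have near_u (u : R) : 0 < u -> nbhs xb [set y | `|y - xb| < u].
  move=> u0; have := @cvg_id _ (nbhs xb); move/cvgr_dist_lt => /(_ u u0).
  by apply: filterS => y /=; rewrite distrC.
have [dl dl0 good] : exists2 dl : R, 0 < dl & forall y, `|y - xb| < dl ->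
    [/\ forall l p, kkt f y l p -> h <= `|p|,
      forall j, `|f j y - f j xb| <= e' /\ `|grad (f j) y - grad (f j) xb| <= e',
      forall j, f j y = Phi f y -> f j xb = Phi f xb &
      forall j, `|f j y - f j xb - dot (grad (f j) xb) (y - xb)| <= e * `|y - xb|].
  have : \forall y \near xb, [/\ forall l p, kkt f y l p -> h <= `|p|,
      forall j, `|f j y - f j xb| <= e' /\ `|grad (f j) y - grad (f j) xb| <= e',
      forall j, f j y = Phi f y -> f j xb = Phi f xb &
      forall j, `|f j y - f j xb - dot (grad (f j) xb) (y - xb)| <= e * `|y - xb|].
    near=> y; split; near: y.
    - exact: near_h.
    - exact: near_values_grads.
    - by apply: near_active => j; exact: differentiable_continuous.
    - apply: (@filter_forall _ _ _ _ (nbhs_filter xb)) => j.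
      exact: grad_expansion.
  move=> /nbhs_normP [dl /= dl0 sub]; exists dl => // y yd.
  by apply: sub; rewrite /= /ball_ distrC.
have PB k : `|x k - xb| < dl -> `|P k| <= B.
  move=> /good [_ vg _ _]; have [ls -> _] := iter_kkt (xiter k).
  rewrite normrN; apply: norm_gcomb_le => // j.
  have := ler_normD (grad (f j) (x k) - grad (f j) xb) (grad (f j) xb).
  rewrite subrK; have := gbB j; have := (vg j).2; lra.
have [k0 [k0d k0P]] : exists k0, `|x k0 - xb| < dl / 2 /\
    Phi f (x k0) - Phi f xb < h * dl / 4.
  have c0 : 0 < h * dl / 8 by rewrite divr_gt0 ?mulr_gt0.
  have [|k0 _ [a1 a2]] := xacc [set y | `|y - xb| < dl / 2 /\
      Phi f y - Phi f xb <= h * dl / 8] 0.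
    near=> y; split.
      by near: y; apply: near_u; rewrite divr_gt0.
    apply: le_trans (ler_norm _) _; apply: Phi_dist_le => j; move: j.
    have : forall j, `|f j y - f j xb| <= h * dl / 8 /\
        `|grad (f j) y - grad (f j) xb| <= h * dl / 8.
      by near: y; exact: near_values_grads.
    by move=> fy j; exact: (fy j).1.
  by exists k0; split=> //; apply: le_lt_trans a2 _; lra.
have hP k : `|x k - xb| < dl -> h <= `|P k|.
  by move=> /good [+ _ _ _]; apply; exact: iter_kkt (xiter k).
have trap := iterates_trapped h dl k0 h0 hP k0d k0P.
pose q := P k0.
have xk0 : `|x k0 - xb| < dl by have := (trap 0%N).1; rewrite addn0.
have qB : `|q| <= B by exact: PB.
have Pq i : `|P (k0 + i)%N - q| <= e.
  have [_ vgi _ _] := good _ (trap i).1; have [_ vg0 _ _] := good _ xk0.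
  have dist2 (V : normedModType R) (u v w : V) :
      `|u - w| <= e' -> `|v - w| <= e' -> `|u - v| <= 2 * e'.
    rewrite (distrC v) => uw vw; have := ler_normD (u - w) (w - v).
    by rewrite subrKA; lra.
  rewrite -(@ler_pXn2r _ 2) ?nnegrE ?(ltW e0) //.
  apply: le_trans e'8.
  apply: le_trans (kkt_dist f _ _ _ _ _ _ (2 * e') B
    (iter_kkt (xiter _)) (iter_kkt (xiter _)) _ _ _ _ _) _.
  - by rewrite mulr_ge0 // ltW.
  - by move=> j; apply: (dist2 R^o); [exact: (vgi j).1|exact: (vg0 j).1].
  - by move=> j; apply: dist2; [exact: (vgi j).2|exact: (vg0 j).2].
  - by apply: PB; exact: (trap i).1.
  - by [].
  have := ler_wpM2l (ltW e'0) KB1; rewrite -/K; lra.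
have tail_acc (u : R) m : 0 < u -> exists2 k, (m <= k)%N & `|x (k0 + k)%N - xb| < u.
  move=> u0; have [k mk xku] := xacc _ (k0 + m)%N (near_u u u0).
  have k0k := leq_trans (leq_addr m k0) mk.
  by exists (k - k0)%N; [rewrite leq_subRL|rewrite subnKC].
have tail_next i : x (k0 + i.+1)%N = x (k0 + i)%N + b (k0 + i)%N *: P (k0 + i)%N.
  by rewrite addnS; exact: iter_next (xiter _).
have [r [br rsmall xr]] := finite_length_tail xb (fun i => x (k0 + i)%N)
  (fun i => P (k0 + i)%N) (fun i => b (k0 + i)%N) q e _ tail_next
  (fun i => iter_ge0 (xiter (k0 + i)%N)) Pq (fun i => (trap i).2)
  tail_acc.
(* The first bound keeps trial points, at distance at most [4 * B * r] from [xb], within [dl]; the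
   second gives [r * enorm p < 1], since [enorm p <= K * B]. *)
have u0 : 0 < Num.min (dl / (4 * B)) (K * B)^-1.
  by rewrite lt_min divr_gt0 ?mulr_gt0 //= invr_gt0.
have [i ri] := rsmall _ u0.
have [it xi pi] := And3 (xiter (k0 + i)%N) (trap i).1 (PB _ (trap i).1).
have [hpi vgi acti expi] := good _ xi.
have p0 : P (k0 + i)%N != 0.
  by rewrite -normr_gt0 (lt_le_trans h0) // hP.
have r0 : 0 < r i.
  by apply: lt_le_trans (br i); exact: (iter_gt0 it).
have [r1 r2] : r i * (4 * B) < dl /\ r i * (K * B) < 1.
  move: ri; rewrite lt_min => /andP[].
  by rewrite ltr_pdivlMr ?mulr_gt0 // -[_^-1]mul1r ltr_pdivlMr.
have rp : r i * enorm (P (k0 + i)%N) < 1.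
  apply: le_lt_trans r2; rewrite ler_pM2l //.
  rewrite -(@ler_pXn2r _ 2) ?nnegrE ?enorm_ge0 ?(ltW KB0) // enorm_sqr.
  apply: le_trans (ler_norm _) _; apply: le_trans (norm_dot_le _ _) _.
  rewrite -/K -mulrA exprMn ler_pM ?mulr_ge0 ?(le_trans _ K1) //.
    by rewrite expr2 ler_peMr // (le_trans _ K1).
  by rewrite expr2 ler_pM.
have [t [rt t2r rej]] := iter_rejected it p0 (r i) (br i) rp.
(* The optimality condition of [q] at [x k0] is transferred to [xb]: the values cost [2 * e'] and
   the gradient [K * e * B]. *)
have slope j : f j xb = Phi f xb ->
    dot (grad (f j) xb) q <= - (h ^+ 2 - 3 * (K * B * e)).
  move=> jact; have [_ vg0 _ _] := good _ xk0.
  have [ls _ /(_ j) kj] := iter_kkt (xiter k0).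
  have := simplex_sum_le _ (fun j => f j (x k0)) _ ls (fun j => Phi_ge f j (x k0)).
  rewrite -/(fcomb _ _ _).
  have := Phi_dist_le f _ _ _ (fun j => (vg0 j).1).
  have [f0 g0] := vg0 j.
  have := norm_dot_le (grad (f j) (x k0) - grad (f j) xb) q.
  have h1 : K * `|grad (f j) (x k0) - grad (f j) xb| * `|q| <= K * e * B.
    apply: ler_pM => //; rewrite ?mulr_ge0 ?(le_trans _ K1) //.
    by rewrite ler_wpM2l ?(le_trans _ K1) // (le_trans g0).
  have h2 : h ^+ 2 <= dot q q.
    apply: le_trans (sqr_norm_le_dot q); rewrite ler_pXn2r ?nnegrE ?(ltW h0) //.
    exact: hP.
  have h3 := ler_wpM2r (ltW e0) KB1.
  move: kj f0; rewrite -/K -/q jact dotBl !ler_norml.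
  move=> kj /andP[f1 f2] /andP[d1 d2] /andP[a1 a2]; lra.
have := rejected_slope_small f xb (x (k0 + i)%N) (P (k0 + i)%N) q (r i) t e _ B
  (D (k0 + i)%N) B1 e0 e1 r0 (ltW rt) t2r _ pi qB (Pq i) (xr i) _ _
  (iter_active it) slope rej.
rewrite -/K => concl.
suff : h ^+ 2 - 3 * (K * B * e) <= 24 * (K * B * e).
  have : 0 < K * B * e by rewrite mulr_gt0.
  by lra.
apply: concl.
- by move=> j; apply: le_trans (gbB j) _; lra.
- move=> y yE j.
  have yd : `|y - xb| < dl.
    case: yE => -> //; apply: le_lt_trans r1.
    have -> : x (k0 + i)%N + t *: P (k0 + i)%N - xb =
      (x (k0 + i)%N - xb + r i *: q) - r i *: q + t *: P (k0 + i)%N.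
      by rewrite addrK addrAC.
    apply: le_trans (ler_normD _ _) _; rewrite normrZ gtr0_norm ?(lt_trans r0) //.
    have := ler_normB (x (k0 + i)%N - xb + r i *: q) (r i *: q).
    rewrite normrZ gtr0_norm //; have := xr i.
    have := ler_wpM2l (ltW r0) qB.
    have t0 : 0 < t by exact: lt_trans rt.
    have := ler_wpM2l (ltW t0) pi.
    have : t * B <= 2 * r i * B by rewrite ler_pM2r.
    have : e * r i <= B * r i by rewrite ler_pM2r // (le_trans e1).
    lra.
  by have [_ _ ya ye] := good _ yd; split; [exact: ye|exact: ya].
- by move=> j; apply: le_trans (vgi j).2 _.
Unshelve. all: by end_near. Qed.

End Iterates.

Theorem theorem6 (R : realType) (N n : nat) (f : 'I_N.+1 -> 'rV[R]_n -> R)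
  (H1 : exists M : R, forall x j, M <= f j x)
  (H2C1 : forall j, C1 (f j))
  (H2 : exists w : R -> R, modulus w /\
          forall j x y, enorm (grad (f j) x - grad (f j) y) <= w (enorm (x - y)))
  (x : nat -> 'rV[R]_n) (hx : algorithmX f x)
  (xbar : 'rV[R]_n) (hacc : cluster (x @ \oo) xbar) :
  forall d : 'rV[R]_n, 0 <= dirder (Phi f) xbar d.
Proof.
have df j y : differentiable (f j) y by case: (H2C1 j).
have gc j : continuous (grad (f j)) by case: (H2C1 j).
have [L /choice[P /choice[b /choice[D xiter]]]] :=
  choice (algorithmX_iteration f df x hx).
apply: (@accumulation_dirder_ge0 _ _ _ f xbar x P L b D) => // U m xU.
(* Testing the cluster point against tails of the sequence yields arbitrarily late iterates in
   [U]. *)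
have xm : (x @ \oo) (x @` [set k | (m <= k)%N]) by exists m => // k mk; exists k.
have [_ [[k mk <-] Uk]] := hacc _ U xm xU.
by exists k.
Qed.
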